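(* For every choice of the broken lines $l_n$ ($n\ge 1$) as specified in the context, the space $P=\bigcup_{i=1}^\infty l_i\subset\mathbb{R}^2$ is not an attractor of any weakly contracting iterated function system on $\mathbb{R}^2$.
   Context: $\mathbb{R}^2$ carries the Euclidean metric $d$, and points of $\mathbb{R}^2$ are written here in polar coordinates $(r,\theta)$. Construction of $P$: put $p_0=(0,0)$ (the origin) and, for $n\ge 1$, let $p_n$ be the point with polar coordinates $(2^{-n},2^{-n})$. For each $n\ge 1$ choose a broken line segment (polygonal arc) $l_n$ without self-intersections, consisting of finitely many straight line intervals, which starts at $p_0$, ends at $p_n$, has total length $2^n$, and is contained in the set which in polar coordinates is $$\bigl[[0,2^{-n})\times(2^{-n}-2^{-n-2},\,2^{-n}+2^{-n-2})\bigr]\cup\{p_n\},$$ where the first factor is the range of $r$ and the second the range of $\theta$ (so the set includes the origin). Define $P=\bigcup_{i=1}^\infty l_i$. Let $(X,d)$ be a complete metric space. A map $f:X\to X$ is a weak contraction if $d(f(x),f(y))<d(x,y)$ for all $x,y\in X$ with $x\ne y$. A weakly contracting iterated function system on $X$ is a finite nonempty family $F=\{f_1,\dots,f_m\}$ of weak contractions $f_i:X\to X$. For compact $K\subset X$ put $F(K)=\bigcup_{i=1}^m f_i(K)$ (the Barnsley–Hutchinson operator). An attractor of $F$ is a nonempty compact set $A\subset X$ with $F(A)=A$. *)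

(* Defs.v *)
From HB Require Import structures.
From mathcomp Require Import all_boot all_order all_algebra.
From mathcomp Require Import boolp classical_sets functions reals topology.
From mathcomp Require Import trigo.
From mathcomp Require Import ring lra.

Set Implicit Arguments.
Unset Strict Implicit.
Unset Printing Implicit Defensive.

Import Order.TTheory GRing.Theory Num.Theory.

Local Open Scope classical_set_scope.
Local Open Scope ring_scope.

(* The library gives R * R the sup distance; [plane R] is an alias of R * R
   whose metric (hence topology) comes from the Euclidean distance instead. *)
Definition plane (R : realType) : Type := (R * R)%type.

HB.instance Definition _ (R : realType) := Choice.copy (plane R) (R * R)%type.

Definition euclidean_dist (R : realType) (x y : plane R) : R :=
  Num.sqrt ((x.1 - y.1) ^+ 2 + (x.2 - y.2) ^+ 2).

Section euclidean_dist.
Context {R : realType}.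
Implicit Types x y z : plane R.

Lemma euclidean_distxx x : euclidean_dist x x = 0.
Proof. by rewrite /euclidean_dist !subrr expr0n addr0 sqrtr0. Qed.

Lemma euclidean_dist_sym x y : euclidean_dist x y = euclidean_dist y x.
Proof. by congr Num.sqrt; ring. Qed.

Lemma euclidean_dist_positivity x y : euclidean_dist x y = 0 -> x = y.
Proof.
case: x y => [a b] [c d] /eqP; rewrite sqrtr_eq0 /= => h.
have : (a - c) ^+ 2 + (b - d) ^+ 2 == 0.
  by rewrite eq_le h addr_ge0 ?sqr_ge0.
rewrite paddr_eq0 ?sqr_ge0// !sqrf_eq0 !subr_eq0.
by move=> /andP[/eqP -> /eqP ->].
Qed.

Lemma euclidean_dist_triangle y x z :
  euclidean_dist x z <= euclidean_dist x y + euclidean_dist y z.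
Proof.
rewrite /euclidean_dist; case: x y z => [x1 x2] [y1 y2] [z1 z2] /=.
rewrite -[x1 - z1](subrKA y1) -[x2 - z2](subrKA y2).
move: (x1 - y1) (x2 - y2) (y1 - z1) (y2 - z2) => a b c d.
have ab0 : 0 <= a ^+ 2 + b ^+ 2 by rewrite addr_ge0 ?sqr_ge0.
have cd0 : 0 <= c ^+ 2 + d ^+ 2 by rewrite addr_ge0 ?sqr_ge0.
rewrite -[leRHS]ger0_norm ?addr_ge0 ?sqrtr_ge0// -sqrtr_sqr ler_wsqrtr//.
rewrite [leRHS]sqrrD !sqr_sqrtr//.
suff : a * c + b * d <=
    Num.sqrt (a ^+ 2 + b ^+ 2) * Num.sqrt (c ^+ 2 + d ^+ 2) by lra.
rewrite -sqrtrM// (le_trans (ler_norm _))// -sqrtr_sqr ler_wsqrtr//.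
rewrite -subr_ge0 (_ : _ - _ = (a * d - b * c) ^+ 2) ?sqr_ge0//; ring.
Qed.

End euclidean_dist.

HB.instance Definition _ (R : realType) := isMetric.Build R (plane R)
  (@euclidean_distxx R) (@euclidean_dist_positivity R) (@euclidean_dist_sym R)
  (@euclidean_dist_triangle R).

Section iterated_function_systems.
Context {R : realType} {X : metricType R}.

Definition weak_contraction (f : X -> X) : Prop :=
  forall x y : X, x <> y -> mdist (f x) (f y) < mdist x y.

Definition weakly_contracting_ifs (m : nat) (F : 'I_m -> X -> X) : Prop :=
  (0 < m)%N /\ forall i : 'I_m, weak_contraction (F i).

Definition hutchinson (m : nat) (F : 'I_m -> X -> X) (K : set X) : set X :=
  \bigcup_(i : 'I_m) (F i @` K).

Definition attractor (m : nat) (F : 'I_m -> X -> X) (A : set X) : Prop :=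
  [/\ A !=set0, compact A & hutchinson F A = A].

End iterated_function_systems.

Section broken_lines.
Context {R : realType}.

Definition segment (a b : plane R) : set (plane R) :=
  [set x | exists2 t : R, 0 <= t <= 1 &
    x = ((1 - t) * a.1 + t * b.1, (1 - t) * a.2 + t * b.2)].

(* A broken line with k edges has vertices v 0, ..., v k; the values of v
   beyond k play no role. *)
Definition broken_line (k : nat) (v : nat -> plane R) : set (plane R) :=
  \bigcup_(i in `I_k) segment (v i) (v i.+1).

Definition broken_line_length (k : nat) (v : nat -> plane R) : R :=
  \sum_(i < k) mdist (v i) (v i.+1).

(* Edges are nondegenerate, and distinct edges meet only at the common vertex
   of two consecutive ones. *)
Definition no_self_intersection (k : nat) (v : nat -> plane R) : Prop :=
  (forall i : nat, (i < k)%N -> v i <> v i.+1) /\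
  (forall (i j : nat) (x : plane R), (i < j < k)%N ->
    segment (v i) (v i.+1) x -> segment (v j) (v j.+1) x ->
    j = i.+1 /\ x = v j).

End broken_lines.

Section construction.
Context {R : realType}.

Definition polar (r theta : R) : plane R := (r * cos theta, r * sin theta).

Definition p_ (n : nat) : plane R :=
  if n == 0%N then (0, 0) else polar (2 ^- n) (2 ^- n).

Definition sector (n : nat) : set (plane R) :=
  [set x | exists r theta : R,
    [/\ 0 <= r < 2 ^- n,
        2 ^- n - 2 ^- n.+2 < theta < 2 ^- n + 2 ^- n.+2 &
        x = polar r theta]]
  `|` [set p_ n].

Definition admissible_line (n : nat) (L : set (plane R)) : Prop :=
  exists (k : nat) (v : nat -> plane R),
    [/\ L = broken_line k v /\ no_self_intersection k v,
        v 0%N = p_ 0,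
        v k = p_ n,
        broken_line_length k v = 2 ^+ n &
        L `<=` sector n].

End construction.

(* Main.v *)
(* Suppose that P is the union of the F_i(P). Pick n so large that 2^-n is less
   than half the norm of every nonzero F_i(p_0), and write p_n = F_i(x) with x
   in l_j. The image under F_i of the part of l_j from p_0 to x is a curve in P
   of length at most 2^j. It starts outside l_n \ {p_0}, and l_n hangs on the
   rest of P at p_0 only, so on its way to the tip p_n it has to run through the
   whole of l_n; hence 2^n <= 2^j and n <= j. But |x| <= 2^-j <= 2^-n: if
   F_i(p_0) = p_0, then 2^-n = |F_i(x)| < |x|, a contradiction; otherwise
   |F_i(x) - F_i(p_0)| <= 2^-n is too small for |F_i(p_0)| > 2 * 2^-n and
   |F_i(x)| = 2^-n. *)
Require Import Defs.
From mathcomp Require Import all_boot all_order all_algebra.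
From mathcomp Require Import boolp classical_sets cardinality reals topology.
From mathcomp Require Import normedtype trigo.
From mathcomp Require Import ring lra.

Set Implicit Arguments.
Unset Strict Implicit.
Unset Printing Implicit Defensive.

Import Order.TTheory GRing.Theory Num.Theory.
Import numFieldTopology.Exports.

Local Open Scope classical_set_scope.
Local Open Scope ring_scope.

Section plane_geometry.
Context {R : realType}.
Implicit Types (x y a b : plane R) (u : R -> plane R) (v : nat -> plane R)
  (L : set (plane R)).

(** * Distances and closed segments in the plane *)

Lemma mdistE x y : mdist x y = Num.sqrt ((x.1 - y.1) ^+ 2 + (x.2 - y.2) ^+ 2).
Proof. by []. Qed.

Lemma mdist_sqr x y :
  mdist x y ^+ 2 = (x.1 - y.1) ^+ 2 + (x.2 - y.2) ^+ 2.
Proof. by rewrite mdistE sqr_sqrtr// addr_ge0 ?sqr_ge0. Qed.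

Lemma lipschitz_closed_le (g : plane R -> R) (C c : R) : 0 < C ->
  (forall x y, g x - g y <= C * mdist x y) -> closed [set x | g x <= c].
Proof.
move=> C0 gC; rewrite -openC openE => x /= /negP; rewrite -ltNge => cgx.
apply/nbhs_ballP; exists ((g x - c) / C); first by rewrite /= divr_gt0 ?subr_gt0.
move=> y; rewrite ballEmdist/= ltr_pdivlMr// => xy; apply/negP; rewrite -ltNge.
have := gC x y; lra.
Qed.

Lemma mdist_segment a b (s t : R) :
  mdist (((1 - s) * a.1 + s * b.1, (1 - s) * a.2 + s * b.2) : plane R)
    ((1 - t) * a.1 + t * b.1, (1 - t) * a.2 + t * b.2) = `|s - t| * mdist a b.
Proof.
rewrite !mdistE /= -sqrtr_sqr -sqrtrM ?sqr_ge0//; congr Num.sqrt; ring.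
Qed.

(* The case of equality in the triangle inequality: it gives closedness of
   segments without a compactness argument. *)
Lemma segmentE a b :
  segment a b = [set x | mdist a x + mdist x b <= mdist a b].
Proof.
apply/seteqP; split => [_ [t /andP[t0 t1] ->]|x] /=.
  have ax := mdist_segment a b 0 t; have xb := mdist_segment a b t 1.
  move: ax xb; rewrite subr0 subrr !mul1r !mul0r !addr0 !add0r -!surjective_pairing.
  move=> -> ->; rewrite normrN ger0_norm// ler0_norm ?subr_le0//.
  by rewrite -mulrDl opprB addrC subrK mul1r.
have [-> |/eqP ab] := eqVneq a b.
  rewrite mdistxx => h; exists 0; first by rewrite lexx ler01.
  have : mdist x b = 0.
    by apply/eqP; rewrite eq_le mdist_ge0 andbT (le_trans _ h)// lerDr mdist_ge0.
  move=> /mdist_positivity ->; case: b {h} => b1 b2 /=; congr pair; ring.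
move=> h; set p := mdist a x; set q := mdist x b; set d := mdist a b.
have p0 : 0 <= p by exact: mdist_ge0.
have q0 : 0 <= q by exact: mdist_ge0.
have d0 : 0 < d by rewrite mdist_gt0; exact/eqP.
have dE : d = p + q by apply/eqP; rewrite eq_le h metric_triangle.
have := mdist_sqr a x; have := mdist_sqr x b; have := mdist_sqr a b.
rewrite -/p -/q -/d dE => H1 H2 H3.
(* The vectors [q (a - x)] and [p (x - b)] coincide: expanding the squared norm of their difference
   with [d = p + q] gives 0. So [x] divides the segment in the ratio [p : q], whence the parameter
   [p / d]. *)
have K : (q * (a.1 - x.1) - p * (x.1 - b.1)) ^+ 2 +
         (q * (a.2 - x.2) - p * (x.2 - b.2)) ^+ 2 = 0.
  have -> : forall a1 a2 x1 x2 b1 b2 : R,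
    (q * (a1 - x1) - p * (x1 - b1)) ^+ 2 + (q * (a2 - x2) - p * (x2 - b2)) ^+ 2
    = q ^+ 2 * ((a1 - x1) ^+ 2 + (a2 - x2) ^+ 2) +
      p ^+ 2 * ((x1 - b1) ^+ 2 + (x2 - b2) ^+ 2) -
      p * q * (((a1 - b1) ^+ 2 + (a2 - b2) ^+ 2) -
        ((a1 - x1) ^+ 2 + (a2 - x2) ^+ 2) - ((x1 - b1) ^+ 2 + (x2 - b2) ^+ 2)).
    by move=> *; ring.
  rewrite -H1 -H2 -H3; ring.
move/eqP: K; rewrite paddr_eq0 ?sqr_ge0// !sqrf_eq0 => /andP[/eqP K1 /eqP K2].
have pq0 : p + q != 0 by rewrite -dE gt_eqF.
exists (p / d).
  by rewrite divr_ge0 ?(ltW d0)//= ler_pdivrMr// mul1r dE lerDl.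
have E (z w y : R) : q * (z - w) - p * (w - y) = 0 -> w = (1 - p / d) * z + p / d * y.
  move=> zwy; apply: (mulfI pq0); apply/eqP; rewrite -subr_eq0 dE.
  apply/eqP; transitivity (- (q * (z - w) - p * (w - y))); last first.
    by rewrite zwy oppr0.
  by field.
by rewrite [LHS]surjective_pairing (E _ _ _ K1) (E _ _ _ K2).
Qed.

Lemma segment_closed a b : closed (segment a b).
Proof.
rewrite segmentE.
apply: (@lipschitz_closed_le (fun x => mdist a x + mdist x b) 2) => // x y.
have := metric_triangle a y x; have := metric_triangle x y b.
rewrite (metric_sym y x); lra.
Qed.

Lemma segmentl a b : segment a b a.
Proof. by rewrite segmentE /= mdistxx add0r. Qed.

Lemma segmentr a b : segment a b b.
Proof. by rewrite segmentE /= mdistxx addr0. Qed.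

Lemma segment_subl a b x : segment a b x -> segment a x `<=` segment a b.
Proof.
rewrite !segmentE => /= axb y /= ayx.
have := metric_triangle y x b; lra.
Qed.

Lemma broken_line_closed k v : closed (broken_line k v).
Proof. by apply: closed_bigcup => [|i _]; [exact: finite_II|]; exact: segment_closed. Qed.

(** * Paths of speed at most one *)

(** Elapsed time bounds the length of the curve run through, so no notion of arc length is needed,
    and composing with a weak contraction keeps the property. *)
Definition nonexpansive u := forall s t, mdist (u s) (u t) <= `|s - t|.

Lemma nonexpansive_le u :
  (forall s t, s <= t -> mdist (u s) (u t) <= t - s) -> nonexpansive u.
Proof.
move=> uP s t; have [st|/ltW ts] := leP s t.
  by rewrite distrC ger0_norm ?subr_ge0// uP.
by rewrite ger0_norm ?subr_ge0// metric_sym uP.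
Qed.

Lemma nonexpansive_continuous u : nonexpansive u -> continuous u.
Proof.
move=> uP t; apply/cvg_ballP => e e0; near=> s.
rewrite ballEmdist/= (le_lt_trans (uP _ _))//; near: s.
exact: (@cvgr_dist_lt R R^o).
Unshelve. all: by end_near. Qed.

(** Connectedness of [[s, t]]: without a common point, the times spent in [A] would form a nonempty
    clopen part of the interval, hence all of it, and [u t] would be in both sets. *)
Lemma nonexpansive_crossing u (A B : set (plane R)) (s t : R) :
    nonexpansive u -> closed A -> closed B -> (forall r, A (u r) \/ B (u r)) ->
    s <= t -> A (u s) -> B (u t) ->
  exists r, [/\ s <= r, r <= t, A (u r) & B (u r)].
Proof.
move=> /nonexpansive_continuous/continuous_closedP cu cA cB uAB st As Bt.
apply: contrapT => noc.
have AnB r : s <= r <= t -> A (u r) -> ~ B (u r).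
  by move=> /andP[sr rt] Ar Br; apply: noc; exists r.
have stA : [set` `[s, t]] `&` u @^-1` A = [set` `[s, t]].
  apply: (@segment_connected R s t).
  - by exists s; split => //=; rewrite in_itv/= lexx.
  - exists (u @^-1` (~` B)); first by rewrite preimage_setC openC; exact: cu.
    apply/seteqP; split => r [/= rst ?]; split => //.
      by apply: AnB => //; move: rst; rewrite in_itv.
    by have [] := uAB r.
  - by exists (u @^-1` A) => //; exact: cu.
have tst : s <= t <= t by rewrite st lexx.
have [_ At] : ([set` `[s, t]] `&` u @^-1` A) t by rewrite stA /= in_itv.
exact: (AnB t).
Qed.

Lemma segment_path a b : exists w, [/\ nonexpansive w, w 0 = a,
  w (mdist a b) = b & forall t, segment a b (w t)].
Proof.
have [<- |/eqP ab] := eqVneq a b.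
  exists (fun=> a); split => // [s t|_]; first by rewrite mdistxx.
  exact: segmentl.
set d := mdist a b; have d0 : 0 < d by rewrite mdist_gt0; exact/eqP.
(* Clamping [t / d] to [[0, 1]] makes the path wait at [a] before time 0 and at [b] after time
   [d]. *)
pose c t := Num.max 0 (Num.min 1 (t / d)).
have c01 t : 0 <= c t <= 1.
  by rewrite /c le_max lexx/= ge_max ler01 ge_min lexx.
exists (fun t => ((1 - c t) * a.1 + c t * b.1, (1 - c t) * a.2 + c t * b.2)).
have c0 : c 0 = 0 by rewrite /c mul0r min_r ?ler01// maxxx.
have c1 : c d = 1 by rewrite /c divff ?gt_eqF// minxx max_r ?ler01.
split.
- apply: nonexpansive_le => s t st; rewrite mdist_segment -/d.
  rewrite -ler_pdivlMr// mulrBl.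
  have : s / d <= t / d by rewrite ler_pM2r ?invr_gt0.
  rewrite distrC /c; move: (s / d) (t / d) => {st} x y xy.
  have : Num.max 0 (Num.min 1 x) <= Num.max 0 (Num.min 1 y).
    by apply: le_max2 => //; apply: le_min2.
  rewrite -subr_ge0 => /ger0_norm ->.
  by case: (leP 1 x) => ?; case: (leP 1 y) => ?; rewrite ?(max_r (@ler01 R));
    try (case: (leP 0 x) => ?); try (case: (leP 0 y) => ?); lra.
- by rewrite c0 [RHS]surjective_pairing; congr pair; ring.
- by rewrite c1 [RHS]surjective_pairing; congr pair; ring.
- by move=> t; exists (c t).
Qed.

Lemma nonexpansive_glue u w (c : R) : nonexpansive u -> nonexpansive w ->
  u c = w 0 -> nonexpansive (fun t => if t <= c then u t else w (t - c)).
Proof.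
move=> ue we uw; apply: nonexpansive_le => s t st.
have [tc|ct] := leP t c.
  by rewrite (le_trans st tc) (le_trans (ue _ _))// distrC ger0_norm ?subr_ge0.
have [sc|cs] := leP s c; last first.
  rewrite (le_trans (we _ _))// distrC ger0_norm; lra.
have := metric_triangle (u s) (u c) (w (t - c)).
have := ue s c; rewrite distrC ger0_norm ?subr_ge0// => h1.
have := we 0 (t - c); rewrite -uw distrC subr0 ger0_norm; last lra.
lra.
Qed.

(** * Broken lines: following them and traversing them *)

Lemma broken_line_lengthS k v :
  broken_line_length k.+1 v = broken_line_length k v + mdist (v k) (v k.+1).
Proof. by rewrite /broken_line_length big_ord_recr. Qed.

Lemma broken_line_length_ge0 k v : 0 <= broken_line_length k v.
Proof. by apply: sumr_ge0 => i _; exact: mdist_ge0. Qed.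

Lemma broken_lineS k v :
  broken_line k.+1 v = broken_line k v `|` segment (v k) (v k.+1).
Proof. by rewrite /broken_line !bigcup_mkord big_ord_recr. Qed.

Lemma broken_line_le j k v : (j <= k)%N -> broken_line j v `<=` broken_line k v.
Proof. by move=> jk x [i /= ij ix]; exists i => //=; exact: leq_trans jk. Qed.

(** The alternative [u t = v 0] serves [k = 0], where the broken line has no edge and is the empty
    set. *)
Lemma broken_line_path k v : exists u, [/\ nonexpansive u, u 0 = v 0%N,
  u (broken_line_length k v) = v k &
  forall t, u t = v 0%N \/ broken_line k v (u t)].
Proof.
elim: k => [|k [u [ue u0 uk ul]]].
  by exists (fun=> v 0%N); split => // [s t|t]; [rewrite mdistxx|left].
have [w [we w0 wd wl]] := segment_path (v k) (v k.+1).
set L := broken_line_length k v in uk *.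
exists (fun t => if t <= L then u t else w (t - L)); split.
- by apply: nonexpansive_glue; rewrite ?uk.
- by rewrite broken_line_length_ge0.
(* At the final time the test [t <= L] succeeds only if the last edge has length 0, and then its two
   ends coincide. *)
- rewrite broken_line_lengthS -/L; case: ifPn => [|_].
    rewrite gerDl => d0; have : mdist (v k) (v k.+1) = 0.
      by apply/eqP; rewrite eq_le d0 mdist_ge0.
    by move=> /[dup] /mdist_positivity <- ->; rewrite addr0.
  by rewrite addrC addKr.
- move=> t; rewrite broken_lineS; case: ifP => _; last by right; right.
  by have [->|] := ul t; [left|right; left].
Qed.

(** Follow the edges up to the start of an edge containing [x], then go straight to [x] inside that
    edge. *)
Lemma broken_line_path_to k v x : broken_line k v x -> exists u T,
  [/\ nonexpansive u, 0 <= T <= broken_line_length k v, u 0 = v 0%N, u T = x &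
    forall t, broken_line k v (u t)].
Proof.
move=> [i /= ik ix]; have [u [ue u0 uk ul]] := broken_line_path i v.
have [w [we w0 wd wl]] := segment_path (v i) x.
set L := broken_line_length i v in uk *.
exists (fun t => if t <= L then u t else w (t - L)), (L + mdist (v i) x); split.
- by apply: nonexpansive_glue; rewrite ?uk.
- rewrite addr_ge0 ?broken_line_length_ge0 ?mdist_ge0//=.
  have : broken_line_length i.+1 v <= broken_line_length k v.
    pose d j := mdist (v j) (v j.+1).
    rewrite /broken_line_length -!(big_mkord xpredT d).
    rewrite (big_cat_nat (leq0n i.+1) ik)//= lerDl sumr_ge0// => j _.
    exact: mdist_ge0.
  apply: le_trans; rewrite broken_line_lengthS lerD2l.
  move: ix; rewrite segmentE /=; apply: le_trans.
  by rewrite lerDl mdist_ge0.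
- by rewrite broken_line_length_ge0.
- case: ifPn => [|_]; last by rewrite addrC addKr.
  rewrite gerDl => d0; have : mdist (v i) x = 0.
    by apply/eqP; rewrite eq_le d0 mdist_ge0.
  by move=> /[dup] /mdist_positivity <- ->; rewrite addr0.
- move=> t; case: ifP => _.
    have [->|] := ul t; last by apply: broken_line_le; exact: ltnW.
    by exists 0%N; [exact: leq_ltn_trans ik|exact: segmentl].
  by exists i => //; apply: segment_subl ix _ _.
Qed.

(* Going backwards from the end, [u] visits v_k, v_(k-1), ..., v_0 at decreasing
   times: to reach the part of the broken line beyond v_j it has to pass
   through v_j, the only point common to that part and the rest of its range. *)
Lemma traverse_length k v (C : set (plane R)) u (T : R) :
    no_self_intersection k v -> closed C ->
    C `&` broken_line k v `<=` [set v 0%N] ->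
    nonexpansive u -> (forall t, C (u t) \/ broken_line k v (u t)) ->
    0 <= T -> C (u 0) -> u T = v k ->
  broken_line_length k v <= T.
Proof.
move=> [vneq vinj] Ccl Cv ue uCv T0 Cu0 uT.
(* Induction on the number [i] of edges counted from the end: the time left after the visit to the
   vertex [v (k - i)] is at least the length of the edges beyond it. *)
suff H i : (i <= k)%N -> exists t : R, [/\ 0 <= t, u t = v (k - i)%N &
    broken_line_length k v - broken_line_length (k - i) v <= T - t].
  have [t [t0 _]] := H k (leqnn k).
  rewrite subnn {2}/broken_line_length big_ord0; lra.
elim: i => [_|i IH ik]; first by exists T; rewrite subn0; split; rewrite ?subrr.
have [t [t0 ut tT]] := IH (ltnW ik).
set j := (k - i.+1)%N; have jS : (k - i)%N = j.+1 by rewrite /j -subSn// subSS.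
rewrite jS in ut tT.
have jk : (j < k)%N by rewrite -jS leq_subr.
(* [A] is what lies before [v j], [B] the edges from [v j] on. The path goes from [A] at time 0 to
   [B] at time [t]. *)
pose A := C `|` broken_line j v.
pose B := \bigcup_(i in [set i | (j <= i < k)%N]) segment (v i) (v i.+1).
have [] // := @nonexpansive_crossing u A B 0 t.
- by apply: closedU => //; exact: broken_line_closed.
- apply: closed_bigcup => [|l _]; last exact: segment_closed.
  by apply: (sub_finite_set _ (finite_II k)) => l /= /andP[].
- move=> r; have [Cr|[l /= lk lr]] := uCv r; first by left; left.
  have [lj|jl] := ltnP l j; first by left; right; exists l.
  by right; exists l => //=; rewrite jl.
- by left.
- by exists j => /=; rewrite ?leqnn// ut; exact: segmentr.
move=> s [s0 st As [l /= /andP[jl lk] ls]].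
suff us : u s = v j.
  exists s; split => //; move: tT; rewrite broken_line_lengthS.
  have := ue s t; rewrite us ut distrC ger0_norm ?subr_ge0//; lra.
(* An edge before [v j] and one after it can only meet if they are consecutive, which forces [l = j]
   and the point [v j]. *)
have D l' : (l' < j)%N -> segment (v l') (v l'.+1) (u s) -> u s = v j.
  move=> lj ls'; have [] := vinj l' l (u s) _ ls' ls.
    by rewrite (leq_trans lj jl).
  by move=> ll' ->; congr v; apply/eqP; rewrite eqn_leq jl ll' lj.
case: As => [Cs|[l' lj ls']]; last exact: D ls'.
have us0 : u s = v 0%N by apply: Cv; split => //; exists l.
(* For [j > 0] the point [v 0] lies on edge 0, which comes before [v j]. *)
have [-> //|j0] := posnP j.
by apply: (D 0%N) => //; rewrite us0; exact: segmentl.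
Qed.

(** * Sectors, and the cones that separate them *)

Lemma expV2_le i j : (i <= j)%N -> 2 ^- j <= 2 ^- i :> R.
Proof. by move=> ij; rewrite lef_pV2 ?posrE ?exprn_gt0// ler_eXn2l ?ltr1n. Qed.

Lemma expV2S n : 2 ^- n.+1 = 2 ^- n / 2 :> R.
Proof. by rewrite exprS invfM mulrC. Qed.

Lemma expV2SS n : 2 ^- n.+2 = 2 ^- n / 4 :> R.
Proof. by rewrite !expV2S -mulrA -invfM -natrM. Qed.

Lemma expV2_gt0 n : 0 < 2 ^- n :> R.
Proof. by rewrite invr_gt0 exprn_gt0. Qed.

(** Allowing [r = 2 ^- n] puts the tip and the rest of the sector under one description, with angles
    in the window [(3/4, 5/4)] times [2 ^- n]. *)
Lemma sectorP n x : (1 <= n)%N -> sector n x -> exists r theta : R,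
  [/\ 0 <= r <= 2 ^- n, 2 ^- n * (3 / 4) < theta < 2 ^- n * (5 / 4) &
      x = polar r theta].
Proof.
move=> n1; have h0 := expV2_gt0 n.
case=> [[r [t [/andP[r0 rn]]]]|->].
  rewrite expV2SS => /andP[t1 t2] ->; exists r, t; split => //.
  - by rewrite r0 ltW.
  - by apply/andP; split; lra.
rewrite /p_ gtn_eqF//; exists (2 ^- n), (2 ^- n); split => //.
- by rewrite ltW/=.
- by apply/andP; split; lra.
Qed.

Lemma mdist0_polar (r theta : R) : 0 <= r -> mdist (p_ 0) (polar r theta) = r.
Proof.
move=> r0; rewrite mdistE /= !sub0r !sqrrN !exprMn -mulrDr cos2Dsin2 mulr1.
by rewrite sqrtr_sqr ger0_norm.
Qed.

Lemma mdist0_p n : (1 <= n)%N -> mdist (p_ 0) (p_ n) = 2 ^- n :> R.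
Proof.
by move=> n1; rewrite {2}/p_ gtn_eqF// mdist0_polar// ltW// expV2_gt0.
Qed.

Lemma mdist0_sector n x : (1 <= n)%N -> sector n x -> mdist (p_ 0) x <= 2 ^- n.
Proof.
by move=> n1 /(sectorP n1)[r [t [/andP[r0 rn] _ ->]]]; rewrite mdist0_polar.
Qed.

(** A union of two closed half-planes bounded by the lines through the origin at angles [alpha] and
    [beta]. For [0 < beta - alpha < pi] it omits exactly the open cone of angles between them. *)
Definition cone_complement (alpha beta : R) : set (plane R) :=
  [set x | x.2 * cos alpha - x.1 * sin alpha <= 0] `|`
  [set x | x.1 * sin beta - x.2 * cos beta <= 0].

Lemma linear_form_lipschitz (c d : R) x y : `|c| <= 1 -> `|d| <= 1 ->
  (x.1 * c + x.2 * d) - (y.1 * c + y.2 * d) <= 2 * mdist x y.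
Proof.
move=> c1 d1.
have le1 (a b : R) : `|a| <= Num.sqrt (a ^+ 2 + b ^+ 2).
  by rewrite -sqrtr_sqr ler_wsqrtr// lerDl sqr_ge0.
have h1 : (x.1 - y.1) * c <= mdist x y.
  rewrite (le_trans (ler_norm _))// normrM -[leRHS]mulr1.
  by apply: ler_pM => //; rewrite mdistE; exact: (le1 (x.1 - y.1) (x.2 - y.2)).
have h2 : (x.2 - y.2) * d <= mdist x y.
  rewrite (le_trans (ler_norm _))// normrM -[leRHS]mulr1.
  by apply: ler_pM => //; rewrite mdistE [X in Num.sqrt X]addrC; exact: (le1 (x.2 - y.2) (x.1 - y.1)).
lra.
Qed.

Lemma cone_complement_closed (alpha beta : R) :
  closed (cone_complement alpha beta).
Proof.
have cs (t : R) : `|cos t| <= 1 /\ `|sin t| <= 1.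
  by rewrite !ler_norml cos_geN1 cos_le1 sin_geN1 sin_le1.
apply: closedU; apply: (@lipschitz_closed_le _ 2) => // x y.
- have := @linear_form_lipschitz (- sin alpha) (cos alpha) x y.
  rewrite normrN => /(_ (cs alpha).2 (cs alpha).1); lra.
- have := @linear_form_lipschitz (sin beta) (- cos beta) x y.
  rewrite normrN => /(_ (cs beta).2 (cs beta).1); lra.
Qed.

Lemma cone_complement_polar (alpha beta r theta : R) :
  cone_complement alpha beta (polar r theta) <->
  r * sin (theta - alpha) <= 0 \/ r * sin (beta - theta) <= 0.
Proof.
have -> : r * sin (theta - alpha) =
  r * sin theta * cos alpha - r * cos theta * sin alpha by rewrite sinB; ring.
have -> : r * sin (beta - theta) =
  r * cos theta * sin beta - r * sin theta * cos beta by rewrite sinB; ring.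
by [].
Qed.

(* The open cone complementary to [outside n] contains the tip p_n, at which
   [sector n] is not open. *)
Definition outside n := cone_complement (2 ^- n * (3 / 4)) (2 ^- n * (5 / 4)).

(** Angles scale by at least 2 between different sectors: for [j < n] they exceed [3/2 > 5/4] times
    [2 ^- n], for [j > n] they stay below [5/8 < 3/4] times it. All are small against [pi], which
    fixes the sign of the sine. *)
Lemma sector_outside n j x : (1 <= n)%N -> (1 <= j)%N -> j != n ->
  sector j x -> outside n x.
Proof.
move=> n1 j1 jn /(sectorP j1)[r [t [/andP[r0 _] /andP[t1 t2] ->]]].
apply/cone_complement_polar.
have := expV2_gt0 n; have := expV2_gt0 j.
have := expV2_le n1; have := expV2_le j1; rewrite expr1 => hj hn j0 n0.
have pi2 := @pi_ge2 R.
have neg (a : R) : - pi <= a <= 0 -> r * sin a <= 0.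
  move=> /andP[a1 a2]; rewrite -oppr_ge0 -mulrN -sinN mulr_ge0// sin_ge0_pi//.
  by apply/andP; split; lra.
have [lt|gt|/eqP] := ltngtP j n; last by rewrite (negbTE jn).
- right; apply: neg; have := expV2_le lt; rewrite expV2S => h.
  by apply/andP; split; lra.
- left; apply: neg; have := expV2_le gt; rewrite expV2S => h.
  by apply/andP; split; lra.
Qed.

(** When [r > 0], both angular offsets lie in [(0, pi)], so both half-plane conditions fail. *)
Lemma sector_inside n x : (1 <= n)%N -> sector n x -> outside n x -> x = p_ 0.
Proof.
move=> n1 /(sectorP n1)[r [t [/andP[r0 _] /andP[t1 t2] ->]]].
have n0 := expV2_gt0 n; have := expV2_le n1; rewrite expr1 => hn.
have pi2 := @pi_ge2 R.
have [->|rN0] := eqVneq r 0; first by rewrite /polar !mul0r.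
have {}r0 : 0 < r by rewrite lt_neqAle eq_sym rN0.
have pos (a : R) : 0 < a < pi -> ~ r * sin a <= 0.
  by move=> a0; apply/negP; rewrite -ltNge mulr_gt0// sin_gt0_pi.
by move=> /cone_complement_polar[] /pos[]; apply/andP; split; lra.
Qed.

Lemma line_inside_length n L u (T : R) : (1 <= n)%N -> admissible_line n L ->
  nonexpansive u -> (forall t, outside n (u t) \/ L (u t)) ->
  0 <= T -> outside n (u 0) -> u T = p_ n -> 2 ^+ n <= T.
Proof.
move=> n1 [k [v [[-> vinj] v0 vk <- Ls]]] ue uL T0 u0 uT.
apply: (traverse_length vinj _ _ ue uL) => //; last by rewrite vk.
  exact: cone_complement_closed.
by move=> x [xo /Ls xs]; rewrite /= v0; exact: sector_inside xs xo.
Qed.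

Lemma line_endpoints n L : admissible_line n L -> L (p_ 0) /\ L (p_ n).
Proof.
(* Zero edges would give length 0, not [2 ^+ n]. *)
move=> [[|k] [v [[-> _] <- <- len _]]].
  move: len; rewrite /broken_line_length big_ord0 => /esym/eqP.
  by rewrite expf_eq0 pnatr_eq0 andbF.
split; first by exists 0%N => //; exact: segmentl.
by exists k => /=; [exact: ltnSn|exact: segmentr].
Qed.

Lemma line_path n L x : admissible_line n L -> L x -> exists u T,
  [/\ nonexpansive u, 0 <= T <= 2 ^+ n, u 0 = p_ 0, u T = x &
    forall t, L (u t)].
Proof.
by move=> [k [v [[-> _] <- _ <- _]]] /broken_line_path_to.
Qed.

End plane_geometry.

(** * Weak contractions, choice of [n] and the contradiction *)

Lemma weak_contraction_le (R : realType) (X : metricType R) (f : X -> X) x y :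
  weak_contraction f -> mdist (f x) (f y) <= mdist x y.
Proof.
move=> fw; have [->|/eqP xy] := eqVneq x y; first by rewrite !mdistxx.
exact/ltW/fw.
Qed.

Lemma exists_expV2_lt (R : realType) (m : nat) (e : 'I_m -> R) :
  (forall i, 0 < e i) -> exists2 n, (1 <= n)%N & forall i, 2 ^- n < e i.
Proof.
(* Each Archimedean bound [b] of [(e i)^-1] satisfies [b < 2 ^ b]; the successor ensures
   [1 <= n]. *)
move=> e0; exists (\max_(i < m) Num.bound (e i)^-1).+1 => // i.
rewrite invf_plt ?posrE ?exprn_gt0//.
have /archi_boundP b : 0 <= (e i)^-1 by rewrite invr_ge0 ltW.
apply: lt_trans b _.
apply: (@lt_le_trans _ _ (2 ^+ Num.bound (e i)^-1)).
  by rewrite -natrX ltr_nat ltn_expl.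
by rewrite ler_eXn2l ?ltr1n// leqW// leq_bigmax.
Qed.

Theorem theorem2p5 (R : realType) (l : nat -> set (plane R))
    (l_line : forall n : nat, (1 <= n)%N -> admissible_line n (l n))
    (m : nat) (F : 'I_m -> plane R -> plane R)
    (F_ifs : weakly_contracting_ifs F) :
  ~ attractor F (\bigcup_(i in [set i : nat | (1 <= i)%N]) l i).
Proof.
set P := \bigcup_(i in _) l i; move=> [_ _ FP].
have lS n : (1 <= n)%N -> l n `<=` sector n by move=> /l_line[? [? []]].
have lP n : (1 <= n)%N -> l n `<=` P by move=> n1 x lx; exists n.
have FP' i x : P x -> P (F i x).
  by move=> Px; rewrite -FP; exists i => //; exists x.
have F_le i x y : mdist (F i x) (F i y) <= mdist x y.
  by apply: weak_contraction_le; exact: F_ifs.2.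
pose o : plane R := p_ 0.
have Po : P o.
  by apply: (lP 1%N) => //; have [] := line_endpoints (l_line _ (leqnn 1)).
(* The value 1 is a harmless positive default for maps fixing the origin. *)
pose e i : R := if F i o == o then 1 else mdist o (F i o) / 2.
have e0 i : 0 < e i.
  by rewrite /e; case: eqVneq => // ?; rewrite divr_gt0// mdist_gt0 eq_sym.
have [n n1 ne] := exists_expV2_lt e0.
have : P (p_ n).
  by apply: (lP n) => //; have [] := line_endpoints (l_line _ n1).
rewrite -{1}FP => -[i _ [x [j /= j1 ljx] Fx]].
have xj : mdist o x <= 2 ^- j by apply: mdist0_sector => //; exact: lS.
have h0 := expV2_gt0 (R := R) n.
have Foo : F i o != o -> 2 ^- n < mdist o (F i o) / 2.
  by move=> Fio; have := ne i; rewrite /e (negbTE Fio).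
(* Were [F i o] on [l n] and nonzero, its norm would be at most [2 ^- n], against the choice of
   [n]. *)
have out0 : outside n (F i o).
  have [k k1 lk] := FP' i _ Po.
  have [kn|kn] := eqVneq k n; last exact: sector_outside kn (lS _ k1 _ lk).
  have := mdist0_sector k1 (lS _ k1 _ lk); rewrite kn -/o.
  have [-> _|/Foo] := eqVneq (F i o) o; last lra.
  by rewrite /o /p_ /=; left; rewrite /= !mul0r subrr.
have [u [T [ue /andP[T0 Tj] u0 uT ul]]] := line_path (l_line _ j1) ljx.
have nT : 2 ^+ n <= T.
  apply: (@line_inside_length R n (l n) (F i \o u)) => //=.
  - exact: l_line.
  - by move=> s t; exact: le_trans (F_le _ _ _) (ue _ _).
  - move=> t; have [k k1 lk] : P (F i (u t)) by apply/FP'/(lP j).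
    have [<-|kn] := eqVneq k n; first by right.
    by left; exact: sector_outside kn (lS _ k1 _ lk).
  - by rewrite u0.
  - by rewrite uT.
have nj : (n <= j)%N by have := le_trans nT Tj; rewrite ler_eXn2l ?ltr1n.
have xn : mdist o x <= 2 ^- n := le_trans xj (expV2_le nj).
have pn := mdist0_p (R := R) n1.
have [Fio|/Foo Fio] := eqVneq (F i o) o; last first.
  have := metric_triangle o (F i x) (F i o); have := F_le i x o.
  rewrite Fx (metric_sym x) -/o in pn *; lra.
have ox : o <> x.
  by move=> ox; move: pn; rewrite -Fx -ox Fio mdistxx => h; rewrite -h ltxx in h0.
have := F_ifs.2 i _ _ ox; rewrite Fio Fx pn; lra.
Qed.
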